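(* Let $\mathfrak{F}([0,1]^2)$ be the set of all functions $[0,1]^2\to[0,1]$ with the operation $(f\circ g)(s)=\sup_{x\in[0,1]^2}\min(f(x),g(s))$ for $f,g\in\mathfrak{F}([0,1]^2)$, $s\in[0,1]^2$. The set $\mathcal{W}_0$ of all graphons is a left ideal of the right regular band $(\mathfrak{F}([0,1]^2);\circ)$. Thus the semigroup $(\mathcal{W}_0;\circ)$ is a right regular band, and so it is a semilattice $I$ of right zero subsemigroups $S_i$ ($i\in I$), where two graphons $W_1$ and $W_2$ are in the same $S_i$ if and only if $\sup(W_1)=\sup(W_2)$.
   Context: A fuzzy subset of $[0,1]^2$ is a function $f:[0,1]^2\to[0,1]$, and $\sup(f)=\sup_{x\in[0,1]^2}f(x)$. A graphon is a measurable function $W:[0,1]^2\to[0,1]$ that is symmetric, i.e. $W(x,y)=W(y,x)$ for all $x,y\in[0,1]$; $\mathcal{W}_0$ is the set of all graphons. A left ideal of a semigroup $A$ is a non-empty subset $L$ with $ab\in L$ for all $a\in A$, $b\in L$. A band is a semigroup in which every element is idempotent; a right regular band is a band satisfying the identity $axa=xa$; a right zero semigroup satisfies $ab=b$; a semilattice is a commutative band. A semigroup $A$ is a semilattice $I$ of subsemigroups $S_i$ ($i\in I$) if $I$ is a semilattice, $A$ is the disjoint union of the subsemigroups $S_i$, and $S_iS_j\subseteq S_{ij}$ for all $i,j\in I$ (equivalently, the $S_i$ are the classes of a semilattice congruence on $A$, i.e. a congruence whose quotient is a semilattice). *)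

(* Defs.v *)
From HB Require Import structures.
From mathcomp Require Import all_boot all_order all_algebra.
From mathcomp Require Import interval_inference.
From mathcomp Require Import all_classical all_reals all_analysis.

Set Implicit Arguments.
Unset Strict Implicit.
Unset Printing Implicit Defensive.

Import Order.TTheory GRing.Theory Num.Theory.
Import numFieldNormedType.Exports.

Local Open Scope classical_set_scope.
Local Open Scope ring_scope.

(* Semigroups are given by a carrier [A : set T] and an operation on [T], so
   that subsemigroups and ideals share the operation of the ambient semigroup.
   They are non-empty. *)
Section Semigroups.
Context {T : Type} (op : T -> T -> T).
Implicit Types A L : set T.

Definition semigroup A :=
  [/\ A !=set0,
      forall a b, A a -> A b -> A (op a b) &
      forall a b c, A a -> A b -> A c -> op a (op b c) = op (op a b) c].

Definition band A := semigroup A /\ forall a, A a -> op a a = a.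

Definition right_regular_band A :=
  band A /\ forall a x, A a -> A x -> op (op a x) a = op x a.

Definition right_zero_semigroup A :=
  semigroup A /\ forall a b, A a -> A b -> op a b = b.

Definition semilattice A :=
  band A /\ forall a b, A a -> A b -> op a b = op b a.

Definition subsemigroup B A := semigroup B /\ B `<=` A.

Definition left_ideal L A :=
  [/\ L !=set0, L `<=` A & forall a b, A a -> L b -> L (op a b)].

(* The index semilattice is the whole type [I]. *)
Definition semilattice_of_subsemigroups A (I : Type) (opI : I -> I -> I)
    (S : I -> set T) :=
  [/\ forall i, subsemigroup (S i) A,
      \bigcup_i S i = A,
      trivIset setT S &
      forall i j a b, S i a -> S j b -> S (opI i j) (op a b)].

End Semigroups.

Section Fuzzy.
Context {R : realType}.

Definition square : Type := ({i01 R} * {i01 R})%type.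

Definition fuzzy : Type := square -> {i01 R}.

Definition fuzzy_range (f : fuzzy) : set R := range (fun x => (f x)%:num).

Lemma fuzzy_range_has_sup f : has_sup (fuzzy_range f).
Proof.
split; first by exists (f (0%:i01, 0%:i01))%:num, (0%:i01, 0%:i01).
by exists 1 => _ [x _ <-].
Qed.

Lemma fuzzy_sup_ge0 f : 0 <= sup (fuzzy_range f).
Proof.
have [[r fr] ub] := fuzzy_range_has_sup f.
by apply: le_trans (ub_le_sup ub fr); case: fr => x _ <-.
Qed.

Lemma fuzzy_sup_le1 f : sup (fuzzy_range f) <= 1.
Proof.
have [ne _] := fuzzy_range_has_sup f.
by apply: ge_sup => // _ [x _ <-].
Qed.

Definition fuzzy_sup (f : fuzzy) : {i01 R} :=
  Itv01 (fuzzy_sup_ge0 f) (fuzzy_sup_le1 f).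

Definition fuzzy_op (f g : fuzzy) : fuzzy :=
  fun s => fuzzy_sup (fun x => Order.min (f x) (g s)).

(* The Caratheodory sets of the outer measure induced by the product of two
   copies of the Lebesgue measure are the Lebesgue measurable subsets of the
   plane, i.e., the completion of the Borel ones. *)
Definition lebesgue_measurable2 : set (set (R * R)) :=
  ((@lebesgue_measure R \x @lebesgue_measure R)%E^*%mu).-cara.-measurable.

Definition square_incl (s : square) : R * R := (s.1%:num, s.2%:num).

(* A subset of the square is measurable iff its image in the plane is. *)
Definition fuzzy_measurable (f : fuzzy) :=
  forall B : set R, measurable B ->
    lebesgue_measurable2 (square_incl @` [set s | B (f s)%:num]).

Definition graphons : set fuzzy :=
  [set W | fuzzy_measurable W /\ forall x y, W (x, y) = W (y, x)].

End Fuzzy.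

Arguments square : clear implicits.
Arguments fuzzy : clear implicits.
Arguments graphons : clear implicits.

(* Main.v *)
Require Import Defs.
From mathcomp Require Import all_boot all_order all_algebra.
From mathcomp Require Import interval_inference.
From mathcomp Require Import all_classical all_reals all_analysis.
From mathcomp Require Import measurable_realfun.

(** Truncation commutes with suprema, so [(f o g)(s) = min(sup f, g(s))]: the
    product [f o g] is [g] cut off at the height [sup f] ([fuzzy_opE]).  Cutting
    [g] off at the height [c] also cuts its supremum off at [c], hence
    [sup (f o g) = min(sup f, sup g)] ([fuzzy_sup_op]): the supremum is a
    homomorphism onto the chain [[0, 1]] under minimum, which is a semilattice.
    Every algebraic claim is now a statement about minima.  Associativity and
    the identities [aa = a] and [axa = xa] are those of [min], together with the
    fact that cutting [g] off at a height [>= sup g] changes nothing; the latter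
    also says that [f o g = g] as soon as [sup f = sup g], so the fibres of the
    supremum are right zero semigroups.

    Graphons form a left ideal because a truncation [min(c, W)] of a graphon is
    a graphon ([graphon_truncate]).  Constant functions are graphons
    ([graphon_cst]), so every value in [[0, 1]] is the supremum of a graphon and
    each fibre is non-empty; the fibres thus give the decomposition
    ([semilattice_of_fibers]). *)

Import Order.TTheory GRing.Theory Num.Theory.
Local Open Scope classical_set_scope.

Section Bands.
Context {T : Type} {op : T -> T -> T}.

Lemma sub_right_regular_band (A B : set T) :
  right_regular_band op A -> B !=set0 -> B `<=` A ->
  (forall a b, B a -> B b -> B (op a b)) -> right_regular_band op B.
Proof.
move=> [[[_ _ opA] opxx] opaxa] B0 BA Bop; split; first split; first split => //.
- by move=> a b c /BA Aa /BA Ab /BA Ac; exact: opA.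
- by move=> a /BA; exact: opxx.
- by move=> a x /BA Aa /BA Ax; exact: opaxa.
Qed.

Section Fibers.
Context {A : set T} {I : Type} {opI : I -> I -> I} {h : T -> I}.
Hypothesis bandA : band op A.
Hypothesis slI : semilattice opI [set: I].
Hypothesis hM : forall a b, A a -> A b -> h (op a b) = opI (h a) (h b).
Hypothesis h_onto : forall i, exists2 a, A a & h a = i.

Let fiber (i : I) : set T := [set a | A a /\ h a = i].

(** A fibre is closed under the operation because its value is idempotent in
    the quotient. *)
Lemma fiber_semigroup i : semigroup op (fiber i).
Proof.
have [[_ Aop opA] _] := bandA; have [[_ opII] _] := slI.
split; first by have [a Aa ha] := h_onto i; exists a.
- by move=> a b [Aa ha] [Ab hb]; split; [exact: Aop|rewrite hM// ha hb opII].
- by move=> a b c [Aa _] [Ab _] [Ac _]; exact: opA.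
Qed.

Lemma semilattice_of_fibers : semilattice_of_subsemigroups op A opI fiber.
Proof.
have [[_ Aop _] _] := bandA; split.
- by move=> i; split; [exact: fiber_semigroup|move=> a []].
- by apply/seteqP; split=> [a [i _ []]//|a Aa]; exists (h a).
- by move=> i j _ _ [a [[_ <-] [_ <-]]].
- by move=> i j a b [Aa ha] [Ab hb]; split; [exact: Aop|rewrite hM// ha hb].
Qed.

End Fibers.
End Bands.

Lemma min_semilattice {d : Order.disp_t} {I : orderType d} (i0 : I) :
  semilattice (@Order.min d I) [set: I].
Proof.
split; last by move=> i j _ _; exact: minC.
split; last by move=> i _; exact: minxx.
by split=> [|//|i j k _ _ _]; [exists i0|exact: minA].
Qed.

Section Fuzzy.
Local Open Scope ring_scope.
Context {R : realType}.
Implicit Types (f g : fuzzy R) (c d : {i01 R}) (s : square R).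

Lemma fuzzy_sup_leP f c : reflect (forall s, (f s <= c)%O) (fuzzy_sup f <= c)%O.
Proof.
have [ne ub] := fuzzy_range_has_sup f.
apply: (iffP idP) => [fc s|fc].
  apply: le_trans fc; rewrite -num_le /=.
  by apply: ub_le_sup => //; exists s.
by rewrite -num_le /=; apply: ge_sup => // _ [s _ <-]; rewrite num_le.
Qed.

Lemma fuzzy_le_sup f s : (f s <= fuzzy_sup f)%O.
Proof. exact: (fuzzy_sup_leP _ _ (lexx _)). Qed.

Lemma fuzzy_sup_cst c : fuzzy_sup (fun=> c) = c.
Proof.
apply/le_anti/andP; split; first by apply/fuzzy_sup_leP.
exact: (fuzzy_le_sup (fun=> c) (0%:i01, 0%:i01)).
Qed.

(** Both sides have the same upper bounds [d]: in a chain, [min(f(s), c) <= d]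
    for all [s] means that [c <= d] or [f <= d] everywhere. *)
Lemma fuzzy_sup_min f c :
  fuzzy_sup (fun s => Order.min (f s) c) = Order.min (fuzzy_sup f) c.
Proof.
have ubE d : (fuzzy_sup (fun s => Order.min (f s) c) <= d)%O =
             (Order.min (fuzzy_sup f) c <= d)%O.
  rewrite [RHS]ge_min; apply/fuzzy_sup_leP/orP => [fcd|].
    have [cd|dc] := leP c d; [by right|left].
    apply/fuzzy_sup_leP => s.
    by have := fcd s; rewrite ge_min [(c <= d)%O]leNgt dc orbF.
  by case=> [/fuzzy_sup_leP fd|cd] s; rewrite ge_min ?fd// cd orbT.
by apply/le_anti; rewrite -ubE lexx ubE lexx.
Qed.

Lemma fuzzy_opE f g s : fuzzy_op f g s = Order.min (fuzzy_sup f) (g s).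
Proof. exact: fuzzy_sup_min. Qed.

Lemma fuzzy_sup_op f g :
  fuzzy_sup (fuzzy_op f g) = Order.min (fuzzy_sup f) (fuzzy_sup g).
Proof.
rewrite minC -fuzzy_sup_min; congr fuzzy_sup.
by apply/funext => s; rewrite fuzzy_opE minC.
Qed.

Lemma fuzzy_op_id f g : (fuzzy_sup g <= fuzzy_sup f)%O -> fuzzy_op f g = g.
Proof.
move=> gf; apply/funext => s; rewrite fuzzy_opE.
by apply/min_idPr/(le_trans _ gf)/fuzzy_le_sup.
Qed.

Lemma fuzzy_opA f g k : fuzzy_op f (fuzzy_op g k) = fuzzy_op (fuzzy_op f g) k.
Proof. by apply/funext => s; rewrite !fuzzy_opE fuzzy_sup_op minA. Qed.

Lemma fuzzy_right_regular_band :
  right_regular_band (@fuzzy_op R) [set: fuzzy R].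
Proof.
split; first split; first split=> //.
- by exists (fun=> 0%:i01).
- by move=> f g k _ _ _; exact: fuzzy_opA.
- by move=> f _; exact: fuzzy_op_id.
- move=> f g _ _; apply/funext => s.
  rewrite !fuzzy_opE fuzzy_sup_op (minC (fuzzy_sup f)) -minA.
  by congr Order.min; apply/min_idPr; exact: fuzzy_le_sup.
Qed.

Lemma range_num_i01 : range (fun c => c%:num) = `[0%R, 1%R]%classic :> set R.
Proof.
apply/seteqP; split=> [_ [c _ <-]|r]; rewrite /= in_itv/=.
  by apply/andP; split.
by case/andP=> r0 r1; exists (Itv01 r0 r1).
Qed.

(** The image of the square is a product of two intervals, hence Borel, and
    every Borel set is a Caratheodory set. *)
Lemma lebesgue_measurable2_square :
  lebesgue_measurable2 (@square_incl R @` [set: square R]).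
Proof.
have -> : @square_incl R @` [set: square R] =
          `[0%R, 1%R]%classic `*` `[0%R, 1%R]%classic.
  rewrite -range_num_i01; apply/seteqP; split=> [_ [s _ <-]|[x y]].
    by split; [exists s.1|exists s.2].
  by case=> -[c _ /= <-] [d _ <-]; exists (c, d).
by apply: sub_caratheodory; apply: sub_sigma_algebra; exact: measurableX.
Qed.

Lemma graphon_cst c : graphons R (fun=> c).
Proof.
split=> // B _; have [Bc|nBc] := pselect (B c%:num).
  have -> : [set s : square R | B c%:num] = setT by apply/seteqP; split.
  exact: lebesgue_measurable2_square.
have -> : [set s : square R | B c%:num] = set0 by apply/seteqP; split.
by rewrite image_set0; exact: measurable0.
Qed.

(** The preimage of [B] under [min(c, W)] is the preimage under [W] of the set
    of reals [r] with [min(c, r)] in [B], which is Borel again. *)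
Lemma graphon_truncate c (W : fuzzy R) :
  graphons R W -> graphons R (fun s => Order.min c (W s)).
Proof.
move=> [mW symW]; split=> [B mB|x y]; last by rewrite symW.
have mmin : measurable_fun [set: R] (fun r => Order.min c%:num r).
  by apply: measurable_minr; [exact: measurable_cst|exact: measurable_id].
have mpre : measurable ((fun r => Order.min c%:num r) @^-1` B).
  by rewrite -[X in measurable X]setTI; exact: mmin.
have := mW _ mpre; congr (lebesgue_measurable2 (_ @` _)).
by apply/funext => s /=; rewrite num_min.
Qed.

Lemma graphon_left_ideal :
  left_ideal (@fuzzy_op R) (graphons R) [set: fuzzy R].
Proof.
split=> //; first by exists (fun=> 0%:i01); exact: graphon_cst.
move=> f W _ /(graphon_truncate (fuzzy_sup f)).
by congr (graphons R _); apply/funext => s; rewrite fuzzy_opE.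
Qed.

End Fuzzy.

Theorem theorem3p4 (R : realType) :
  [/\ right_regular_band (@fuzzy_op R) [set: fuzzy R],
      left_ideal (@fuzzy_op R) (graphons R) [set: fuzzy R],
      right_regular_band (@fuzzy_op R) (graphons R) &
      exists (I : Type) (opI : I -> I -> I) (S : I -> set (fuzzy R)),
        [/\ semilattice opI [set: I],
            semilattice_of_subsemigroups (@fuzzy_op R) (graphons R) opI S,
            forall i, right_zero_semigroup (@fuzzy_op R) (S i) &
            forall W1 W2, graphons R W1 -> graphons R W2 ->
              (exists i, S i W1 /\ S i W2) <-> fuzzy_sup W1 = fuzzy_sup W2]].
Proof.
have rrbF := @fuzzy_right_regular_band R.
have idealG := @graphon_left_ideal R.
have rrbG : right_regular_band (@fuzzy_op R) (graphons R).
  have [G0 GF FG] := idealG.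
  by apply: sub_right_regular_band rrbF G0 GF _ => f W _; exact: FG.
have [bandG _] := rrbG.
have slI : semilattice Order.min [set: {i01 R}].
  exact: (min_semilattice (0%:i01)%R).
have supM f g : graphons R f -> graphons R g ->
    fuzzy_sup (fuzzy_op f g) = Order.min (fuzzy_sup f) (fuzzy_sup g).
  by move=> _ _; exact: fuzzy_sup_op.
have sup_onto i : exists2 W, graphons R W & fuzzy_sup W = i.
  by exists (fun=> i); [exact: graphon_cst|exact: fuzzy_sup_cst].
split=> //.
exists {i01 R}, Order.min, (fun i => [set W | graphons R W /\ fuzzy_sup W = i]).
split=> //.
- exact: semilattice_of_fibers bandG slI supM sup_onto.
- move=> i; split; first exact: fiber_semigroup bandG slI supM sup_onto i.
  by move=> f g [_ fi] [_ gi]; apply: fuzzy_op_id; rewrite fi gi.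
- move=> W1 W2 G1 G2; split=> [[i [[_ ->] [_ ->]]]//|sup12].
  by exists (fuzzy_sup W2).
Qed.
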